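(* For any $C>0$, there exist $\alpha_0\in(0,1)$ and positive integers $a_1,a_2,a_3$ such that the following holds. Let $0<\alpha<\alpha_0$ and $P=\{0,a_1,a_2,a_3\}$. For all sufficiently large $N$, there exists $A\subseteq[N]$ with $|A|\ge\alpha N$ such that for all nonzero integers $d$, there are at most $\alpha^CN$ points $x\in\mathbb{Z}$ with $x+d\cdot P\subseteq A$.
   Context: $[N]=\{1,\dots,N\}$ and $x+d\cdot P=\{x+dt:t\in P\}$. *)

(* Defs.v *)
From HB Require Import structures.
From mathcomp Require Import all_boot all_order all_algebra.
From mathcomp Require Import finmap.
From mathcomp Require Import all_classical all_reals all_analysis.

Set Implicit Arguments.
Unset Strict Implicit.
Unset Printing Implicit Defensive.

Import Order.TTheory GRing.Theory Num.Theory.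
Import numFieldNormedType.Exports.

Local Open Scope classical_set_scope.
Local Open Scope ring_scope.

Definition int_range (N : nat) : set int := [set n : int | 1 <= n <= N%:Z].

Definition affine_copy (x d : int) (P : set int) : set int :=
  [set x + d * t | t in P].

(* [fset_set S] is empty when [S] is infinite, so finiteness is required
   explicitly in the upper bound on the size. *)
Definition card_at_most (R : realType) (S : set int) (r : R) : Prop :=
  finite_set S /\ (#|` fset_set S|)%:R <= r.

(* Main.v *)
Require Import Defs.
From mathcomp Require Import all_boot all_order all_algebra.
From mathcomp Require Import finmap.
From mathcomp Require Import all_classical all_reals all_analysis.
From mathcomp Require Import zify ring.

Set Implicit Arguments.
Unset Strict Implicit.
Unset Printing Implicit Defensive.

Import Order.TTheory GRing.Theory Num.Theory.
Import numFieldNormedType.Exports.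

Local Open Scope ring_scope.

(** Let t = h^2 + (h + 1)^2. The values y0, y1, y2, y3 of a quadratic
polynomial at the points of x + d * {h, 2 h + 1, 0, (h + 1) (2 h + 1)}, in this
order, satisfy t (y1 - 2 y0 + y2) = y3 - y0. For large t this relation has only
constant solutions in certain sets of integers below M, of size M^(1 - eps)
with eps -> 0. At one scale, take the numbers p(t) where p is a polynomial of
degree < s with small nonnegative coefficients: the relation lifts to X (p1 - 2
p0 + p2) = p3 - p0, which at X = -j says that p0(-j) is a weighted average of
the other three values. So, as on Behrend's sphere, fixing suitable weighted
sums of the squares p(-1)^2, ..., p(-s)^2 leaves no nonconstant solution. Such
a set is then iterated over the digits in a larger base.

Fatten a relation-free set to a set F of residues modulo m, and let A consist
of the x <= N for which x^2 + b lies in F, where b makes A at least as dense as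
F. A copy x + d * P in A forces (x + d h)^2 - x^2, which is linear in x, into a
short arc modulo m; this is rare as soon as gcd(d, m) is small compared to m,
and a modulus m between N and 2 N without small divisors has this property for
every 0 < |d| < m. *)

Lemma leq_wexp2r m n e : (m <= n)%N -> (m ^ e <= n ^ e)%N.
Proof. by case: e => // e mn; rewrite leq_exp2r. Qed.

Lemma small_multiple_eq0 (q x r : int) : x * q + r = 0 -> `|r| < q ->
  x = 0 /\ r = 0.
Proof.
move=> xqr rq; have [x_gt0|x_lt0|x0] := ltgtP 0 x; last by split; nia.
- have : q <= x * q by nia.
  by lia.
- have : q <= (- x) * q by nia.
  by lia.
Qed.

Lemma sum_ord4 (V : nmodType) (F : 'I_4 -> V) :
  \sum_i F i = F 0 + F 1 + F 2 + F 3.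
Proof.
rewrite !big_ord_recl big_ord0 addr0 !addrA.
by congr (F _ + F _ + F _ + F _); exact: val_inj.
Qed.

Lemma exists_ge_average (I : finType) (F : I -> nat) : (0 < #|I|)%N ->
  exists i, (\sum_j F j <= F i * #|I|)%N.
Proof.
move=> /card_gt0P[i0 _]; have [i _ Fi_max] := @arg_maxnP I i0 xpredT F isT.
by exists i; rewrite mulnC -sum_nat_const; apply: leq_sum => j _; exact: Fi_max.
Qed.

Lemma exists_large_fiber (T V : finType) (f : T -> V) : (0 < #|T|)%N ->
  exists v, (#|T| <= #|[set t | f t == v]| * #|V|)%N.
Proof.
move=> /card_gt0P[t _].
have [|v] := exists_ge_average (fun v => #|[set t | f t == v]|).
  by apply/card_gt0P; exists (f t).
suff -> : (\sum_v #|[set t | f t == v]| = #|T|)%N by exists v.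
rewrite -[RHS]sum1_card (partition_big f xpredT) //=; apply: eq_bigr => u _.
by rewrite -sum1_card; apply: eq_bigl => x; rewrite inE.
Qed.

(** * Linear forms *)

Definition lin_form (R : pzRingType) k (c x : 'I_k -> R) : R :=
  \sum_i c i * x i.

Definition norm1 k (c : 'I_k -> int) : nat := \sum_i `|c i|%N.

Definition only_constant_solutions k (c : 'I_k -> int) Q (S : {set 'I_Q}) :
    Prop :=
  forall x : 'I_k -> 'I_Q, (forall i, x i \in S) ->
  lin_form c (fun i => (x i)%:Z) = 0 -> forall i j, x i = x j.

Lemma horner_lin_form (R : comNzRingType) k (c p : 'I_k -> {poly R}) (t : R) :
  (lin_form c p).[t] = lin_form (fun i => (c i).[t]) (fun i => (p i).[t]).
Proof. by rewrite horner_sum; apply: eq_bigr => i _; rewrite hornerM. Qed.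

Lemma lin_formD (R : pzRingType) k (c x y : 'I_k -> R) :
  lin_form c (fun i => x i + y i) = lin_form c x + lin_form c y.
Proof. by rewrite -big_split; apply: eq_bigr => i _; rewrite mulrDr. Qed.

Lemma lin_formMr (R : pzRingType) k (c x : 'I_k -> R) (q : R) :
  lin_form c (fun i => x i * q) = lin_form c x * q.
Proof. by rewrite [RHS]mulr_suml; apply: eq_bigr => i _; rewrite mulrA. Qed.

Lemma lin_form_lt_norm1 k (c x : 'I_k -> int) (B : nat) : (0 < norm1 c)%N ->
  (forall i, `|x i| < B%:Z) -> `|lin_form c x| < (norm1 c * B)%:Z.
Proof.
case: k c x => [|k] c x c_gt0 x_lt; first by rewrite /norm1 big_ord0 in c_gt0.
apply: (@le_lt_trans _ _ (norm1 c * B.-1)%:Z); last first.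
  by have := x_lt ord0; rewrite ltz_nat ltn_pmul2l //; lia.
rewrite (le_trans (ler_norm_sum _ _ _)) // PoszM -natz natr_sum mulr_suml.
apply: ler_sum => i _; rewrite normrM natz abszE ler_wpM2l //.
by have := x_lt i; lia.
Qed.

Lemma lin_form_divmod_eq0 k (c x r : 'I_k -> int) (B q : nat) :
  (0 < norm1 c)%N -> (norm1 c * B <= q)%N -> (forall i, `|r i| < B%:Z) ->
  lin_form c (fun i => x i * q%:Z + r i) = 0 ->
  lin_form c x = 0 /\ lin_form c r = 0.
Proof.
move=> c_gt0 cB_q r_lt; rewrite lin_formD lin_formMr => /small_multiple_eq0.
by apply; apply: lt_le_trans (lin_form_lt_norm1 c_gt0 r_lt) _; rewrite lez_nat.
Qed.

(** * Digits *)

Lemma small_coef_root_eq0 (q : nat) (p : {poly int}) :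
  (forall i, `|p`_i| < q%:Z) -> p.[q%:Z] = 0 -> p = 0.
Proof.
elim/poly_ind: p => [//|p c IHp] small.
rewrite hornerMXaddC => /small_multiple_eq0 [].
  by have := small 0%N; rewrite coefD coefMX coefC /= add0r.
move=> pq0 c0; rewrite c0 polyC0 addr0 IHp ?mul0r // => i.
by have := small i.+1; rewrite coefD coefMX coefC /= addr0.
Qed.

Lemma lin_form_horner_eq0 k (c p : 'I_k -> {poly int}) (q : nat) :
  (forall j, `|(lin_form c p)`_j| < q%:Z) ->
  lin_form (fun i => (c i).[q%:Z]) (fun i => (p i).[q%:Z]) = 0 ->
  lin_form c p = 0.
Proof.
move=> small form0; apply: (small_coef_root_eq0 small).
by rewrite horner_lin_form.
Qed.

Section Digits.

Variables s L : nat.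
Implicit Types X Y : {ffun 'I_s -> 'I_L}.

Definition digit_poly X : {poly int} := rVpoly (\row_j (X j)%:Z).

Lemma coef_digit_poly X (j : 'I_s) : (digit_poly X)`_j = X j.
Proof. by rewrite coef_rVpoly_ord mxE. Qed.

Lemma digit_poly_inj : injective digit_poly.
Proof.
move=> X Y XY; apply/ffunP => j; apply/val_inj.
by have := coef_digit_poly X j; rewrite XY coef_digit_poly => -[].
Qed.

Lemma coef_digit_poly_bound X i : (0 < L)%N -> 0 <= (digit_poly X)`_i < L%:Z.
Proof.
move=> L_gt0; rewrite coef_rVpoly; case: insubP => [j _ _|_]; last first.
  by rewrite lexx.
by rewrite mxE lez_nat ltz_nat ltn_ord.
Qed.

Lemma horner_digit_poly X (x : int) :
  (digit_poly X).[x] = \sum_(j < s) (X j)%:Z * x ^+ j.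
Proof.
by rewrite horner_poly; apply: eq_bigr => j _; rewrite valK mxE.
Qed.

Lemma digits_lt q X : (L <= q)%N -> (\sum_(j < s) X j * q ^ j < q ^ s)%N.
Proof.
move=> Lq; elim: s X => [|t IHt] X; first by rewrite big_ord0.
rewrite big_ord_recr /=.
have : (\sum_(j < t) X (widen_ord (leqnSn t) j) * q ^ j < q ^ t)%N.
  apply: leq_ltn_trans (IHt [ffun j => X (widen_ord (leqnSn t) j)]).
  by apply: leq_sum => j _; rewrite ffunE.
have := ltn_ord (X ord_max); rewrite expnS.
by move: (\sum_(i < t) _)%N (q ^ t)%N (nat_of_ord (X ord_max)) => *; nia.
Qed.

Definition of_digits q (Lq : (L <= q)%N) X : 'I_(q ^ s) :=
  Ordinal (digits_lt X Lq).

Lemma of_digitsE q (Lq : (L <= q)%N) X :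
  (of_digits Lq X)%:Z = (digit_poly X).[q%:Z].
Proof.
rewrite horner_digit_poly -natz natr_sum; apply: eq_bigr => j _.
by rewrite natrM natrX !natz.
Qed.

Lemma of_digits_inj q (Lq : (L <= q)%N) : injective (of_digits Lq).
Proof.
have [s0|s_gt0] := posnP s.
  by move=> X Y _; apply/ffunP => -[j j_lt]; exfalso; rewrite s0 in j_lt.
move=> X Y XY; have L_gt0 : (0 < L)%N.
  exact: leq_ltn_trans (leq0n _) (ltn_ord (X (Ordinal s_gt0))).
apply: digit_poly_inj; apply: subr0_eq; apply: (@small_coef_root_eq0 q) => [i|].
  rewrite coefB; have := coef_digit_poly_bound X i L_gt0.
  have := coef_digit_poly_bound Y i L_gt0.
  by move: (digit_poly X)`_i (digit_poly Y)`_i => x y; lia.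
by rewrite hornerD hornerN -!(of_digitsE Lq) XY subrr.
Qed.

End Digits.

Lemma only_constant_solutions_exp k (c : 'I_k -> int) Q (S : {set 'I_Q}) q n :
  (0 < norm1 c)%N -> (norm1 c * Q <= q)%N -> only_constant_solutions c S ->
  exists2 Sn : {set 'I_(q ^ n)},
    #|Sn| = (#|S| ^ n)%N & only_constant_solutions c Sn.
Proof.
move=> c_gt0 cQq constS.
have Qq : (Q <= q)%N by apply: leq_trans cQq; rewrite leq_pmull.
exists [set of_digits Qq X | X in ffun_on (mem S)].
  by rewrite card_imset ?card_ffun_on ?card_ord //; exact: of_digits_inj.
move=> x x_in form0.
have /fin_all_exists2 [X XS xE] i :
    exists2 X, X \in ffun_on (mem S) & x i = of_digits Qq X.
  exact/imsetP/x_in.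
have X_in i j : X i j \in S by have /ffun_onP := XS i.
suff eqX i j a : X i a = X j a.
  by move=> i j; rewrite !xE; congr of_digits; apply/ffunP.
move: i j; apply: constS => [i|]; first exact: X_in.
have coef_form b : (lin_form (polyC \o c) (@digit_poly _ _ \o X))`_b =
    lin_form c (fun i => (digit_poly (X i))`_b).
  by rewrite coef_sum; apply: eq_bigr => i _; rewrite coefCM.
transitivity ((lin_form (polyC \o c) (@digit_poly _ _ \o X))`_a).
  by rewrite coef_form; apply: eq_bigr => i _; rewrite coef_digit_poly.
rewrite (@lin_form_horner_eq0 _ _ _ q) ?coef0 // => [b|]; last first.
  by rewrite -[RHS]form0; apply: eq_bigr => i _; rewrite hornerC xE of_digitsE.
rewrite coef_form; apply: lt_le_trans (_ : (norm1 c * Q)%:Z <= _); last first.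
  by rewrite lez_nat.
apply: lin_form_lt_norm1 => // i.
have Q_gt0 : (0 < Q)%N := leq_ltn_trans (leq0n _) (ltn_ord (X i a)).
by have := coef_digit_poly_bound (X i) b Q_gt0; lia.
Qed.

(** * Behrend-type sets *)

Lemma weighted_mean_rigid (R : realDomainType) (I J : finType)
    (w x : I -> J -> R) (y : J -> R) :
  (forall i j, 0 < w i j) ->
  (forall j, \sum_i w i j * (x i j - y j) = 0) ->
  (forall i, \sum_j w i j * x i j ^+ 2 = \sum_j w i j * y j ^+ 2) ->
  forall i j, x i j = y j.
Proof.
move=> w_gt0 mean sqr_eq i j.
have sum0 : \sum_i' \sum_j' w i' j' * (x i' j' - y j') ^+ 2 = 0.
  (* (x - y)^2 = (x^2 - y^2) - 2 y (x - y): the first part sums to 0 over j,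
     the second over i. *)
  transitivity (\sum_i' \sum_j' (w i' j' * x i' j' ^+ 2 - w i' j' * y j' ^+ 2) -
      \sum_j' 2 * y j' * \sum_i' w i' j' * (x i' j' - y j')).
    under [X in _ - X]eq_bigr do rewrite mulr_sumr.
    rewrite [X in _ - X]exchange_big -sumrB; apply: eq_bigr => i' _.
    by rewrite -sumrB; apply: eq_bigr => j' _; ring.
  rewrite !big1 ?subr0 // => [j' _|i' _]; first by rewrite mean mulr0.
  by rewrite sumrB sqr_eq subrr.
have term_ge0 i' j' : 0 <= w i' j' * (x i' j' - y j') ^+ 2.
  by rewrite mulr_ge0 ?sqr_ge0 ?ltW.
have row_ge0 i' : 0 <= \sum_j' w i' j' * (x i' j' - y j') ^+ 2.
  exact: sumr_ge0.
have row0 := psumr_eq0P (fun i' _ => row_ge0 i') sum0 (i := i) isT.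
have /eqP := psumr_eq0P (fun j' _ => term_ge0 i j') row0 (i := j) isT.
by rewrite mulf_eq0 gt_eqF //= sqrf_eq0 subr_eq0 => /eqP.
Qed.

Definition quad_coef (R : comNzRingType) (t : R) (i : 'I_4) : R :=
  [:: 1 - 2 * t; t; t; - 1]`_i.

Lemma lin_form_quad_coef (R : comNzRingType) (t : R) (x : 'I_4 -> R) :
  lin_form (quad_coef t) x = t * (x 1 - 2 * x 0 + x 2) - (x 3 - x 0).
Proof. by rewrite /lin_form sum_ord4 /quad_coef /=; ring. Qed.

Lemma horner_quad_coef (R : comNzRingType) (t : R) i :
  (quad_coef 'X i).[t] = quad_coef t i.
Proof.
by case: i => [[|[|[|[|i]]]] //= i4]; rewrite /quad_coef /= !hornerE.
Qed.

(* At [t = - j.+1] the relation says that [x 0] is a weighted average of the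
   other values; the weight at index 0 is irrelevant. *)
Definition mean_weight s (i : 'I_4) (j : 'I_s) : nat :=
  nth 0%N [:: 1%N; j.+1; j.+1; 1%N] i.

Lemma lin_form_quad_coef_neg s (j : 'I_s) (x : 'I_4 -> int) :
  lin_form (quad_coef (- j.+1%:Z)) x =
    - \sum_i (mean_weight i j)%:Z * (x i - x 0).
Proof. by rewrite lin_form_quad_coef sum_ord4 /mean_weight /=; ring. Qed.

Section Energy.

Variables s L : nat.
Implicit Types X Y : {ffun 'I_s -> 'I_L}.

Definition energy (w : 'I_s -> nat) X : nat :=
  \sum_(j < s) w j * `|((digit_poly X).[- j.+1%:Z])%R| ^ 2.

Lemma energyE w X : (energy w X)%:Z =
  \sum_(j < s) (w j)%:Z * (digit_poly X).[- j.+1%:Z] ^+ 2.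
Proof.
rewrite -natz natr_sum; apply: eq_bigr => j _.
by rewrite natrM natrX !natz abszE real_normK ?num_real.
Qed.

Lemma horner_digit_poly_neg_bound X (j : 'I_s) :
  (`|((digit_poly X).[- j.+1%:Z])%R| <= s ^ s.+1 * L)%N.
Proof.
rewrite -lez_nat abszE horner_digit_poly (le_trans (ler_norm_sum _ _ _)) //.
have -> : (s ^ s.+1 * L)%:Z = \sum_(i < s) (s ^ s * L)%:Z.
  by rewrite sumr_const card_ord expnS; lia.
apply: ler_sum => i _.
rewrite normrM normrX normrN mulrC [leRHS]PoszM !ger0_norm //.
apply: ler_pM => //; last by rewrite lez_nat ltnW.
rewrite -natz -natrX natz lez_nat (@leq_trans (s ^ i)) //.
  exact: leq_wexp2r.
by rewrite leq_pexp2l ?(ltnW (ltn_ord i)) // (leq_ltn_trans _ (ltn_ord i)).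
Qed.

Lemma energy_lt w X : (forall j, w j <= s)%N ->
  (energy w X < ((s ^ s.+2 * L) ^ 2).+1)%N.
Proof.
move=> w_le; rewrite ltnS.
have -> : ((s ^ s.+2 * L) ^ 2 = \sum_(j < s) s * (s ^ s.+1 * L) ^ 2)%N.
  by rewrite sum_nat_const card_ord (expnS s s.+1) !expnMn; ring.
apply: leq_sum => j _.
by rewrite leq_mul // leq_sqr horner_digit_poly_neg_bound.
Qed.

Lemma digits_eq_of_horner X Y :
  (forall j : 'I_s, (digit_poly X).[- j.+1%:Z] = (digit_poly Y).[- j.+1%:Z]) ->
  X = Y.
Proof.
move=> XY; apply: digit_poly_inj; apply: subr0_eq.
apply: (@roots_geq_poly_eq0 _ _ [seq - (j : 'I_s).+1%:Z | j <- enum 'I_s]).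
- by apply/allP => _ /mapP[j _ ->]; rewrite rootE !hornerE XY subrr.
- by rewrite map_inj_uniq ?enum_uniq // => i j /oppr_inj [] /val_inj.
- rewrite size_map size_enum_ord (leq_trans (size_polyD _ _)) // size_polyN.
  by rewrite geq_max !size_poly.
Qed.

Lemma quad_relation_rigid (X : 'I_4 -> {ffun 'I_s -> 'I_L}) :
  lin_form (quad_coef 'X) (@digit_poly s L \o X) = 0 ->
  (forall i, energy (mean_weight i) (X i) = energy (mean_weight i) (X 0)) ->
  forall i, X i = X 0.
Proof.
move=> rel energy_eq i; apply: digits_eq_of_horner; move: i.
pose value i (j : 'I_s) := (digit_poly (X i)).[- j.+1%:Z].
apply: (@weighted_mean_rigid _ _ _
  (fun i j => (mean_weight i j)%:Z) value (value 0)).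
- by case=> [[|[|[|[|i]]]] //= i4] j.
- move=> j; apply: oppr_inj; rewrite oppr0 -lin_form_quad_coef_neg.
  rewrite -(horner0 (- j.+1%:Z)) -rel horner_lin_form.
  by apply: eq_bigr => i _; rewrite horner_quad_coef.
- by move=> i; rewrite -!energyE energy_eq.
Qed.

Lemma lin_form_quad_coef_digits_eq0 K (X : 'I_4 -> {ffun 'I_s -> 'I_L}) :
  (0 < L)%N -> (3 * L <= K)%N ->
  lin_form (quad_coef K%:Z) (fun i => (digit_poly (X i)).[K%:Z]) = 0 ->
  lin_form (quad_coef 'X) (@digit_poly s L \o X) = 0.
Proof.
move=> L_gt0 LK rel; apply: (@lin_form_horner_eq0 _ _ _ K) => [j|]; last first.
  by rewrite -[RHS]rel; apply: eq_bigr => i _; rewrite horner_quad_coef.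
have bound i a := coef_digit_poly_bound (X i) a L_gt0.
rewrite lin_form_quad_coef -polyC_natr /= !(coefB, coefD, coefXM, coefCM).
move: (bound 0 j.-1) (bound 1 j.-1) (bound 2 j.-1) (bound 0 j) (bound 3 j).
move: (_)`_j.-1 (_)`_j.-1 (_)`_j.-1 (_)`_j (_)`_j => a b c d e.
by case: (j == 0%N) => *; lia.
Qed.

Lemma exists_quad_behrend_set K : (0 < s)%N -> (0 < L)%N -> (3 * L <= K)%N ->
  exists2 S : {set 'I_(K ^ s)},
    (L ^ s <= #|S| * (2 * s ^ s.+2 * L) ^ 8)%N &
    only_constant_solutions (quad_coef K%:Z) S.
Proof.
move=> s_gt0 L_gt0 LK; have L_le_K : (L <= K)%N by lia.
pose B := ((s ^ s.+2 * L) ^ 2).+1.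
have energy_ltB i X : (energy (mean_weight i) X < B)%N.
  apply: energy_lt => j; have := ltn_ord j.
  by case: i => [[|[|[|[|i]]]] //= i4]; rewrite /mean_weight /=; lia.
have B_le : (B <= (2 * s ^ s.+2 * L) ^ 2)%N.
  have : (0 < s ^ s.+2 * L)%N by rewrite muln_gt0 expn_gt0 s_gt0.
  by rewrite /B -mulnA; move: (s ^ s.+2 * L)%N => x; nia.
pose energies X := [ffun i => Ordinal (energy_ltB i X)].
have [|v fiber_large] := exists_large_fiber energies.
  by rewrite card_ffun !card_ord expn_gt0 L_gt0.
exists [set of_digits L_le_K X | X in [set X | energies X == v]].
  rewrite card_imset; last exact: of_digits_inj.
  move: fiber_large; rewrite !card_ffun !card_ord => /leq_trans; apply.
  by rewrite leq_mul2l (expnM _ 2 4) leq_wexp2r ?orbT.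
move=> x x_in form0.
have /fin_all_exists2 [X Xv xE] i :
    exists2 X, X \in [set X | energies X == v] & x i = of_digits L_le_K X.
  exact/imsetP/x_in.
suff eqX0 i : X i = X 0 by move=> i j; rewrite !xE (eqX0 i) (eqX0 j).
apply: quad_relation_rigid i => [|i].
  apply: (@lin_form_quad_coef_digits_eq0 K) => //.
  by rewrite -[RHS]form0; apply: eq_bigr => i _; rewrite xE of_digitsE.
have energyX i' : energy (mean_weight i) (X i') = v i.
  by move: (Xv i'); rewrite inE => /eqP <-; rewrite ffunE.
by rewrite !energyX.
Qed.

End Energy.

Definition quad_scale (h : nat) : nat := h ^ 2 + h.+1 ^ 2.

Lemma norm1_quad_coef K : (0 < K)%N -> norm1 (quad_coef K%:Z) = (4 * K)%N.
Proof.
by move=> K_gt0; rewrite /norm1 !big_ord_recl big_ord0 /quad_coef /=; lia.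
Qed.

Lemma exists_dense_quad_behrend_set e : (0 < e)%N ->
  exists h q Q (S : {set 'I_Q}),
  let c := quad_coef (quad_scale h)%:Z in
  [/\ (0 < h)%N, (0 < #|S|)%N, (norm1 c * Q <= q)%N,
      (q ^ e <= q * #|S| ^ e)%N & only_constant_solutions c S].
Proof.
move=> e_gt0; pose s := (10 * e)%N; pose D := ((2 * s ^ s.+2) ^ 8)%N.
have s_gt0 : (0 < s)%N by rewrite muln_gt0.
have D_gt0 : (0 < D)%N by rewrite expn_gt0 muln_gt0 expn_gt0 s_gt0.
pose h := (4 * 5 ^ s.+1 * D)%N; pose K := quad_scale h; pose L := (K %/ 3)%N.
have h_gt3 : (3 < h)%N.
  by rewrite /h -mulnA (@leq_pmulr 4) // muln_gt0 expn_gt0.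
have h_le_L : (h <= L)%N by rewrite leq_divRL // /K /quad_scale; nia.
have LK : (3 * L <= K)%N by rewrite mulnC leq_divM.
have KL : (K <= 5 * L)%N.
  by have := ltn_ceil K (isT : 0 < 3)%N; rewrite -/L; lia.
have L_gt0 : (0 < L)%N by lia.
have K_gt0 : (0 < K)%N by lia.
have [S S_large constS] := exists_quad_behrend_set s_gt0 L_gt0 LK.
rewrite expnMn -/D in S_large.
exists h, (4 * K * K ^ s)%N, (K ^ s)%N, S => c; split=> //.
- exact: ltn_trans h_gt3.
- rewrite lt0n; apply: contraTneq S_large => ->.
  by rewrite mul0n -ltnNge expn_gt0 L_gt0.
- by rewrite norm1_quad_coef.
set q := (4 * K * K ^ s)%N.
have q_le : (q <= #|S| * L ^ 10)%N.
  apply: (@leq_trans (h * (#|S| * L ^ 9))); last first.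
    by rewrite (expnS L 9) mulnCA leq_mul2l leq_mul2r h_le_L !orbT.
  apply: (@leq_trans (4 * 5 ^ s.+1 * L * L ^ s)).
    by rewrite /q -!mulnA -!expnS -expnMn leq_mul2l leq_wexp2r.
  apply: leq_trans (leq_mul (leqnn _) S_large) _.
  by rewrite /h (expnS L 8); apply/eq_leq; ring.
rewrite (leq_trans (leq_wexp2r e q_le)) // expnMn -expnM -/s mulnC leq_mul2r.
apply/orP; right; apply: leq_trans (leq_wexp2r s _) _; last first.
  by apply: leq_pmull; rewrite muln_gt0.
by lia.
Qed.

(** * Residues in short arcs *)

Definition nb_range (N : nat) (P : pred int) : nat :=
  #|[set i : 'I_N | P i.+1%:Z]|.

Lemma leq_nb_range N m (P P' : pred int) : (N <= m)%N ->
  (forall x : int, 1 <= x <= N%:Z -> P x -> P' x) ->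
  (nb_range N P <= nb_range m P')%N.
Proof.
move=> Nm PP'; have widen_inj : injective (widen_ord Nm).
  by move=> i j [/val_inj].
rewrite /nb_range -(card_imset _ widen_inj).
apply: subset_leq_card; apply/fintype.subsetP => _ /imsetP[i + ->].
by rewrite !inE; apply: PP'; have := ltn_ord i; lia.
Qed.

Section LinearResidues.

Variables (m v : nat) (e c : int).
Hypothesis m_gt0 : (0 < m)%N.

Let m_neq0 : m%:Z != 0. Proof. by rewrite eqz_nat -lt0n. Qed.

Lemma dvdz_gcd_quotient (x : int) :
  (m%:Z %| e * x)%Z -> ((m %/ gcdn `|e| m)%N%:Z %| x)%Z.
Proof.
rewrite !dvdzE /= abszM => m_dvd; have g_gt0 : (0 < gcdn `|e| m)%N.
  by rewrite gcdn_gt0 m_gt0 orbT.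
rewrite -(dvdn_pmul2r g_gt0) divnK ?dvdn_gcdr // mulnC muln_gcdl dvdn_gcd m_dvd.
exact: dvdn_mulr.
Qed.

Lemma nb_linear_residues_lt :
  (nb_range m (fun x => (((e * x + c) %% m)%Z < v%:Z)%R) <= v + gcdn `|e| m)%N.
Proof.
pose g := gcdn `|e| m; have g_gt0 : (0 < g)%N by rewrite gcdn_gt0 m_gt0 orbT.
have gm : (g %| m)%N := dvdn_gcdr _ _.
pose r (i : 'I_m) := `|((e * i.+1%:Z + c) %% m)%Z|%N.
have rE i : (r i)%:Z = ((e * i.+1%:Z + c) %% m)%Z by rewrite gez0_abs ?modz_ge0.
rewrite /nb_range; set S := [set i | _]; have r_lt i : i \in S -> (r i < v)%N.
  by rewrite inE -rE ltz_nat.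
have block_lt (i : 'I_m) : (i %/ (m %/ g) < g)%N.
  have quotient_gt0 : (0 < m %/ g)%N by rewrite divn_gt0 // dvdn_leq.
  by rewrite ltn_divLR // mulnC (divnK gm).
(* All residues of [e * x + c] are congruent modulo [g], so a residue is
   determined by its quotient by [g], and [x] by its block and its residue. *)
pose h (i : 'I_m) : 'I_g * 'I_(v %/ g).+1 :=
  (Ordinal (block_lt i), inord (r i %/ g)).
have h_inj : {in S &, injective h}.
  move=> i j /r_lt ri /r_lt rj [same_block /(congr1 val)/=].
  rewrite !inordK ?ltnS ?leq_div2r ?(ltnW ri) ?(ltnW rj) // => same_quotient.
  have m_dvd : (m%:Z %| e * (i%:Z - j%:Z) - ((r i)%:Z - (r j)%:Z))%Z.
    have residue_dvd (x : int) : (m%:Z %| e * x + c - ((e * x + c) %% m)%Z)%Z.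
      by rewrite -eqz_mod_dvd modz_mod.
    have := rpredB (residue_dvd i.+1%:Z) (residue_dvd j.+1%:Z); rewrite -!rE.
    by congr (_ %| _)%Z; rewrite !intS; ring.
  have g_dvd : (g%:Z %| (r i)%:Z - (r j)%:Z)%Z.
    have g_dvd_e : (g%:Z %| e * (i%:Z - j%:Z))%Z.
      by rewrite dvdz_mulr // dvdzE dvdn_gcdl.
    have := rpredB g_dvd_e (dvdz_trans (gm : (g%:Z %| m%:Z)%Z) m_dvd).
    by rewrite subKr.
  have eq_r : r i = r j.
    rewrite (divn_eq (r i) g) (divn_eq (r j) g) same_quotient.
    by move: g_dvd; rewrite -eqz_mod_dvd !modz_nat eqz_nat => /eqP ->.
  move: m_dvd; rewrite eq_r subrr subr0 => /dvdz_gcd_quotient.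
  rewrite -eqz_mod_dvd !modz_nat eqz_nat => /eqP same_residue.
  apply: val_inj; rewrite /= (divn_eq i (m %/ g)) (divn_eq j (m %/ g)).
  by rewrite same_block same_residue.
rewrite -/g -(card_in_imset h_inj) (leq_trans (max_card _)) //.
by rewrite card_prod !card_ord mulnS addnC leq_add2r mulnC leq_divM.
Qed.

End LinearResidues.

Section RoughModulus.

Definition rough (M m : nat) : Prop :=
  forall e : nat, (1 < e)%N -> (e %| m)%N -> (M < e)%N.

Lemma exists_rough M N : (M`! < N)%N ->
  exists2 m, (N < m <= 2 * N)%N & rough M m.
Proof.
move=> factN; exists ((N %/ M`!).+1 * M`! + 1)%N.
  have := ltn_ceil N (fact_gt0 M); have := leq_divM N M`!.
  by rewrite mulSn; lia.
move=> e e_gt1 e_dvd; rewrite ltnNge; apply/negP => eM.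
have e_fact : (e %| (N %/ M`!).+1 * M`!)%N.
  by rewrite dvdn_mull // dvdn_fact // eM ltnW.
by move: e_dvd; rewrite dvdn_addr // dvdn1 gtn_eqF.
Qed.

Variables M m : nat.
Hypothesis m_rough : rough M m.

Lemma gcdn_rough_le d : (0 < d < m)%N -> (gcdn d m * M <= m)%N.
Proof.
move=> /andP[d_gt0 dm]; have g_gt0 : (0 < gcdn d m)%N by rewrite gcdn_gt0 d_gt0.
have g_le : (gcdn d m <= d)%N by rewrite dvdn_leq // dvdn_gcdl.
rewrite mulnC -leq_divRL // ltnW // m_rough //; last first.
  by rewrite dvdn_divLR ?dvdn_gcdr // dvdn_mulr.
by rewrite ltn_divRL ?dvdn_gcdr // mul1n (leq_ltn_trans g_le).
Qed.

Lemma coprime_rough e : (0 < e <= M)%N -> coprime e m.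
Proof.
move=> /andP[e_gt0 eM]; rewrite /coprime eqn_leq gcdn_gt0 e_gt0 andbT.
rewrite leqNgt; apply/negP => /m_rough/(_ (dvdn_gcdr _ _)).
by rewrite ltnNge (leq_trans _ eM) // dvdn_leq ?dvdn_gcdl.
Qed.

Lemma gcdn_mulr_rough d e : (0 < e <= M)%N -> gcdn (d * e) m = gcdn d m.
Proof.
by move=> e_range; rewrite !(gcdnC _ m) Gauss_gcdl // coprime_sym coprime_rough.
Qed.

End RoughModulus.

Section FatResidues.

Variables (m g w Q : nat) (S : {set 'I_Q}).

Definition fat_residues : pred int :=
  fun y => [exists a in S, ((y - g%:Z * a%:Z) %% m)%Z < w%:Z].

Lemma card_shift_fat_residues (y : int) :
  (0 < m)%N -> (w <= g)%N -> (g * Q <= m)%N ->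
  (#|S| * w <= #|[set b : 'I_m | fat_residues (y + b%:Z)%R]|)%N.
Proof.
move=> m_gt0 wg gQm; have m_neq0 : m%:Z != 0 by rewrite eqz_nat -lt0n.
pose residue (p : 'I_Q * 'I_w) : int := g%:Z * p.1%:Z + p.2%:Z.
have residue_bound p : 0 <= residue p < m%:Z.
  have := ltn_ord p.1; have := ltn_ord p.2; rewrite /residue.
  move: (nat_of_ord p.1) (nat_of_ord p.2) => a z za aQ.
  by have : (g * a.+1 <= g * Q)%N; [rewrite leq_mul2l aQ orbT | nia].
have shift_lt p : (`|((residue p - y) %% m)%Z| < m)%N.
  by rewrite -ltz_nat gez0_abs ?modz_ge0 // ltz_pmod.
pose shift p := Ordinal (shift_lt p).
have shiftE p : (shift p)%:Z = ((residue p - y) %% m)%Z.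
  by rewrite gez0_abs ?modz_ge0.
have shift_inj : injective shift.
  move=> p p' /(congr1 (fun b : 'I_m => b%:Z)); rewrite !shiftE => eq_mod.
  have : residue p = residue p'.
    rewrite -(modz_small (residue_bound p)) -(modz_small (residue_bound p')).
    by apply/eqP; rewrite -(eqz_modDr (- y)) eq_mod.
  case: p p' {eq_mod} => [a z] [a' z']; rewrite /residue /= => eq_res.
  have [] := @small_multiple_eq0 g%:Z (a%:Z - a'%:Z) (z%:Z - z'%:Z).
  - by move: eq_res; lia.
  - by have := ltn_ord z; have := ltn_ord z'; lia.
  by move=> /subr0_eq[/val_inj ->] /subr0_eq[/val_inj ->].
rewrite -[in leqLHS](card_ord w) -cardsT -cardsX -(card_imset _ shift_inj).
apply: subset_leq_card; apply/fintype.subsetP => _ /imsetP[[a z] + ->].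
rewrite !inE andbT => /= aS; apply/existsP; exists a; rewrite aS.
rewrite (_ : y + _ - _ = (shift (a, z))%:Z + (y - g%:Z * a%:Z)); last by ring.
rewrite shiftE modzDml (_ : _ + _ = z%:Z); last by rewrite /residue /=; ring.
have := residue_bound (a, z); rewrite /residue /= => zm.
by rewrite modz_small ?ltz_nat // le0z_nat; nia.
Qed.

Lemma fat_residues_rigid k (c y : 'I_k -> int) : (0 < m)%N ->
  (0 < norm1 c)%N -> (norm1 c * w <= g)%N -> (norm1 c * (g * Q) <= m)%N ->
  only_constant_solutions c S ->
  (forall i, fat_residues (y i)) -> lin_form c y = 0 ->
  forall i j, ((y i - y j + w%:Z) %% m)%Z < (2 * w)%N%:Z.
Proof.
move=> m_gt0 c_gt0 cwg cgQm constS y_fat form0.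
have m_neq0 : m%:Z != 0 by rewrite eqz_nat -lt0n.
have /fin_all_exists2 [a aS arc] i :
  exists2 a, a \in S & ((y i - g%:Z * a%:Z) %% m)%Z < w%:Z.
  by have /existsP[a /andP[]] := y_fat i; exists a.
pose z i := ((y i - g%:Z * (a i)%:Z) %% m)%Z.
pose l i := ((y i - g%:Z * (a i)%:Z) %/ m)%Z.
have yE i : y i = l i * m%:Z + ((a i)%:Z * g%:Z + z i).
  by have := divz_eq (y i - g%:Z * (a i)%:Z) m; rewrite -/(z i) -/(l i); lia.
have z_ge0 i : 0 <= z i by exact: modz_ge0.
have wg : (w <= g)%N by apply: leq_trans cwg; rewrite leq_pmull.
have z_lt i : `|z i| < w%:Z by rewrite ger0_norm // arc.
have az_lt i : `|(a i)%:Z * g%:Z + z i| < (g * Q)%N%:Z.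
  have : (g * (a i).+1 <= g * Q)%N by rewrite leq_mul2l ltn_ord orbT.
  by move: (z_ge0 i) (z_lt i); move: (z i) (nat_of_ord (a i)) => z' a'; nia.
have [|_ form_az] := lin_form_divmod_eq0 c_gt0 cgQm az_lt (x := l).
  by rewrite -[RHS]form0; apply: eq_bigr => i _; rewrite yE.
have [form_a _] := lin_form_divmod_eq0 c_gt0 cwg z_lt form_az.
move=> i j; have a_eq := constS a aS form_a i j.
rewrite (_ : _ + _ = (l i - l j) * m%:Z + (z i - z j + w%:Z)); last first.
  by rewrite yE [y j]yE a_eq; ring.
have := z_lt j; have := z_lt i; rewrite !ger0_norm // => zi zj.
have diff_ge0 : 0 <= z i - z j + w%:Z by have := z_ge0 i; lia.
rewrite modzMDl -(gez0_abs diff_ge0) modz_nat ltz_nat.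
rewrite (leq_ltn_trans (leq_mod _ _)) // -ltz_nat gez0_abs //.
by have := z_ge0 j; lia.
Qed.

End FatResidues.

Lemma exists_dense_translate (m N t : nat) (F : pred int) (u : int -> int) :
  (0 < m)%N ->
  (forall y, t <= #|[set b : 'I_m | F (y + b%:Z)%R]|)%N ->
  exists b : int, (N * t <= nb_range N (fun x => F (u x + b)%R) * m)%N.
Proof.
move=> m_gt0 dense.
have [|b] := exists_ge_average
  (fun b : 'I_m => nb_range N (fun x => F (u x + b%:Z)%R)).
  by rewrite card_ord.
rewrite card_ord => /(leq_trans _) avg; exists b; apply: avg.
have card_sum (I : finType) (P : pred I) : (#|[set i | P i]| = \sum_i P i)%N.
  by rewrite -sum1dep_card big_mkcond.
under eq_bigr do rewrite /nb_range card_sum; rewrite exchange_big /=.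
rewrite -[X in (X * t)%N](card_ord N) -sum_nat_const.
by apply: leq_sum => i _; rewrite -card_sum.
Qed.

(** * Sets with few copies of a pattern *)

Definition copies k (a : 'I_k -> int) (A : pred int) (d : int) : pred int :=
  fun x => [forall i, A (x + d * a i)].

Lemma nb_copies_eq0 k (a : 'I_k -> int) (i0 i1 : 'I_k) (A : pred int) N d :
  (forall x, A x -> 1 <= x <= N%:Z) -> a i0 != a i1 -> (N <= `|d|)%N ->
  nb_range N (copies a A d) = 0%N.
Proof.
move=> A_range a_neq Nd; apply: eq_card0 => i; rewrite inE.
apply/negbTE/negP => /forallP copy.
have := A_range _ (copy i0); have := A_range _ (copy i1).
have : (`|d| <= `|(d * (a i0 - a i1))%R|)%N.
  by rewrite abszM leq_pmulr // lt0n absz_eq0 subr_eq0.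
by rewrite mulrBr; move: (d * a i0) (d * a i1) => x0 x1; lia.
Qed.

Definition dense_with_few_copies (R : realFieldType) k (a : 'I_k -> int)
    (delta eps : R) : Prop :=
  exists N0 : nat, forall N, (N0 <= N)%N -> exists A : pred int,
  [/\ forall x, A x -> 1 <= x <= N%:Z,
      delta * N%:R <= (nb_range N A)%:R &
      forall d, d != 0 -> (nb_range N (copies a A d))%:R <= eps * N%:R].

Lemma dense_with_few_copiesW (R : realFieldType) k (a : 'I_k -> int)
    (delta delta' eps eps' : R) : delta' <= delta -> eps <= eps' ->
  dense_with_few_copies a delta eps -> dense_with_few_copies a delta' eps'.
Proof.
move=> le_delta le_eps [N0 sparse]; exists N0 => N /sparse[A [? dense few]].
exists A; split=> // [|d /few]; first by rewrite (le_trans _ dense) ?ler_wpM2r.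
by move=> /le_trans; apply; rewrite ler_wpM2r.
Qed.

Section FewCopies.

Variables (k : nat) (c a : 'I_k -> int) (i0 i1 : 'I_k).
Hypothesis c_norm1 : (2 < norm1 c)%N.
Hypothesis c_quadratic :
  forall x d b : int, lin_form c (fun i => (x + d * a i) ^+ 2 + b) = 0.
Hypotheses (a_i0 : a i0 = 0) (a_i1 : a i1 != 0).

Let c_gt0 : (0 < norm1 c)%N := ltnW (ltnW c_norm1).

Lemma nb_copies_squares_fat Q (S : {set 'I_Q}) (N m w : nat) (d b : int) :
  let g := (norm1 c * w)%N in (0 < m)%N -> (N <= m)%N ->
  (norm1 c * (g * Q) <= m)%N -> only_constant_solutions c S ->
  (nb_range N (copies a (fun x => fat_residues m g w S (x ^+ 2 + b)%R) d) <=
    2 * w + gcdn `|(2 * d * a i1)%R| m)%N.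
Proof.
move=> g m_gt0 Nm gQm constS.
pose e := 2 * d * a i1; pose s := (d * a i1) ^+ 2 + w%:Z.
apply: leq_trans (nb_linear_residues_lt (2 * w) e s m_gt0).
apply: leq_nb_range => // x _ /forallP copy.
have := fat_residues_rigid m_gt0 c_gt0 (leqnn _) gQm constS copy
  (c_quadratic x d b) i1 i0.
by rewrite a_i0 mulr0 addr0; congr ((_ %% _)%Z < _); rewrite /e /s; ring.
Qed.

Lemma nb_copies_squares_fat_rough Q (S : {set 'I_Q}) (N m w : nat) (d b : int) :
  let g := (norm1 c * w)%N in
  only_constant_solutions c S -> (N < m)%N -> (m <= 2 * N)%N ->
  rough (4 * Q + 2 * `|a i1|) m -> (norm1 c ^ 2 * Q * w <= m)%N ->
  (0 < `|d| < m)%N ->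
  (nb_range N (copies a (fun x => fat_residues m g w S (x ^+ 2 + b)%R) d) * Q
    <= N)%N.
Proof.
move=> g constS Nm mN m_rough cQw_m d_range.
have gQm : (norm1 c * (g * Q) <= m)%N.
  by apply: leq_trans cQw_m; rewrite /g; lia.
have m_gt0 := leq_ltn_trans (leq0n N) Nm.
have := nb_copies_squares_fat d b m_gt0 (ltnW Nm) gQm constS.
rewrite -mulrA mulrCA 2!abszM (gcdn_mulr_rough m_rough) => [count|]; last first.
  by rewrite muln_gt0 /= lt0n absz_eq0 a_i1 leq_addl.
have gcd_le : (gcdn `|d| m * (4 * Q) <= m)%N.
  apply: leq_trans (gcdn_rough_le m_rough d_range).
  by rewrite leq_mul // leq_addr.
have wQ_le : (9 * (w * Q) <= m)%N.
  by apply: leq_trans cQw_m; rewrite -mulnA (mulnC Q) leq_mul // (leq_sqr 3).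
by rewrite (leq_trans (leq_mul count (leqnn Q))) // mulnDl; lia.
Qed.

Variable R : realFieldType.

Lemma only_constant_dense_few_copies Q (S : {set 'I_Q}) :
  (0 < Q)%N -> only_constant_solutions c S ->
  dense_with_few_copies a
    (#|S|%:R / (2 * norm1 c ^ 2 * Q)%:R : R) (Q%:R^-1).
Proof.
move=> Q_gt0 constS.
pose M := (4 * Q + 2 * `|a i1|)%N; pose W := (norm1 c ^ 2 * Q)%N.
exists (M`! + W).+1 => N N_large.
have [|m /andP[Nm mN] m_rough] := @exists_rough M N; first by lia.
have m_gt0 : (0 < m)%N by lia.
pose w := (m %/ W)%N; pose g := (norm1 c * w)%N.
have W_gt0 : (0 < W)%N by rewrite muln_gt0 expn_gt0 Q_gt0 c_gt0.
have Ww : (W * w <= m)%N by rewrite mulnC leq_divM.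
have w_gt0 : (0 < w)%N by rewrite divn_gt0 //; lia.
have gQm : (norm1 c * (g * Q) <= m)%N.
  by apply: leq_trans Ww; rewrite /W /g; lia.
have [b b_dense] : exists b : int,
    (N * (#|S| * w) <=
      nb_range N (fun x => fat_residues m g w S (x ^+ 2 + b)%R) * m)%N.
  apply: exists_dense_translate => // y; apply: card_shift_fat_residues => //.
    by rewrite leq_pmull.
  by apply: leq_trans gQm; rewrite leq_pmull.
pose A x := (1 <= x <= N%:Z) && fat_residues m g w S (x ^+ 2 + b).
exists A; split=> [x /andP[] //||d d_neq0].
  have den_gt0 : (0 < 2 * norm1 c ^ 2 * Q)%N by rewrite -mulnA muln_gt0.
  rewrite mulrAC ler_pdivrMr ?ltr0n // -!natrM ler_nat (mulnC #|S|).
  rewrite -(leq_pmul2r w_gt0) -mulnA.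
  rewrite (leq_trans b_dense) // -[leqRHS]mulnA leq_mul //.
    by apply: leq_nb_range => // x x_range Fx; rewrite /A x_range.
  by have := ltn_ceil m W_gt0; rewrite -/w -(mulnA 2) -/W; nia.
rewrite mulrC ler_pdivlMr ?ltr0n // -natrM ler_nat.
have [md|dm] := leqP m `|d|%N.
  rewrite (@nb_copies_eq0 _ _ i0 i1) ?(leq_trans (ltnW Nm)) //.
    by move=> x /andP[].
  by rewrite a_i0 eq_sym.
have d_range : (0 < `|d| < m)%N by rewrite lt0n absz_eq0 d_neq0.
apply: leq_trans
  (nb_copies_squares_fat_rough b constS Nm mN m_rough Ww d_range).
rewrite leq_mul2r; apply/orP; right.
apply: leq_nb_range => // x _ /forallP copy.
by apply/forallP => i; have /andP[] := copy i.
Qed.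

Lemma only_constant_dense_few_copies_exp Q (S : {set 'I_Q}) q n :
  (0 < #|S|)%N -> (norm1 c * Q <= q)%N -> only_constant_solutions c S ->
  dense_with_few_copies a ((#|S|%:R / q%:R : R) ^+ (n + 3)) (q%:R ^- n).
Proof.
move=> S_gt0 cQq constS.
have SQ : (#|S| <= Q)%N by rewrite -[leqRHS]card_ord max_card.
have q_gt0 : (0 < q)%N.
  by apply: leq_trans cQq; rewrite muln_gt0 c_gt0 (leq_trans S_gt0).
have [Sn card_Sn constSn] := only_constant_solutions_exp n c_gt0 cQq constS.
apply: dense_with_few_copiesW (only_constant_dense_few_copies _ constSn).
- have margin : (2 * norm1 c ^ 2 * #|S| ^ 3 <= q ^ 3)%N.
    apply: leq_trans (leq_wexp2r 3 (leq_trans (leq_mul (leqnn _) SQ) cQq)).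
    by rewrite expnMn leq_mul2r (expnS _ 2) leq_mul2r (ltnW c_norm1) !orbT.
  rewrite card_Sn expr_div_n -!natrX ler_pdivrMr ?ltr0n ?expn_gt0 ?q_gt0 //.
  rewrite mulrAC ler_pdivlMr ?ltr0n ?muln_gt0 ?expn_gt0 ?q_gt0 ?c_gt0 //.
  rewrite -!natrM ler_nat !expnD -!mulnA leq_mul2l; apply/orP; right.
  rewrite [leqRHS]mulnC (leq_trans _ (leq_mul margin (leqnn _))) //.
  by apply/eq_leq; ring.
- by rewrite natrX.
- by rewrite expn_gt0 q_gt0.
Qed.

End FewCopies.

(* Seen from its first point the pattern is (0, h + 1, - h, t): the relation of
   [quad_coef t] annihilates it and its squares because (h + 1) + (- h) = 1 and
   (h + 1)^2 + (- h)^2 = t. *)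
Definition quad_pattern (h : nat) (i : 'I_4) : int :=
  [:: h%:Z; 2 * h%:Z + 1; 0; (h%:Z + 1) * (2 * h%:Z + 1)]`_i.

Lemma quad_pattern_gt0 h i : (0 < h)%N -> i != 2 -> 0 < quad_pattern h i.
Proof.
by case: i => [[|[|[|[|i]]]] //= i4] h_gt0 _; rewrite /quad_pattern /=; lia.
Qed.

Lemma quad_coef_squares_pattern h (x d b : int) :
  lin_form (quad_coef (quad_scale h)%:Z)
    (fun i => (x + d * quad_pattern h i) ^+ 2 + b) = 0.
Proof.
rewrite lin_form_quad_coef /quad_pattern /quad_scale /=.
by rewrite PoszD !(expnS, expn0, muln1) !PoszM -addn1 PoszD; ring.
Qed.

Lemma exists_dense_few_quad_pattern_copies (R : realFieldType) e : (0 < e)%N ->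
  exists (h : nat) (r q : R),
  [/\ (0 < h)%N, 0 < r < 1, 0 < q, q^-1 <= r ^+ e &
    forall n, dense_with_few_copies (quad_pattern h) (r ^+ (n + 3)) (q ^- n)].
Proof.
move=> e_gt0.
have [h [q [Q [S [h_gt0 S_gt0 cQq q_le constS]]]]] :=
  exists_dense_quad_behrend_set e_gt0.
have scale_gt0 : (0 < quad_scale h)%N by rewrite addn_gt0 !expn_gt0 orbT.
have c_norm1 : (2 < norm1 (quad_coef (quad_scale h)%:Z))%N.
  by rewrite norm1_quad_coef //; lia.
have Sq : (#|S| < q)%N.
  have SQ : (#|S| <= Q)%N by rewrite -[leqRHS]card_ord max_card.
  rewrite (leq_ltn_trans SQ) // (leq_trans _ cQq) //.
  by rewrite ltn_Pmull ?(leq_trans S_gt0) // ltnW.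
have q_gt0 : 0 < q%:R :> R by rewrite ltr0n (leq_ltn_trans _ Sq).
have card_gt0 : 0 < #|S|%:R :> R by rewrite ltr0n.
exists h, (#|S|%:R / q%:R), q%:R; split=> // [||n].
- by rewrite divr_gt0 //= ltr_pdivrMr // mul1r ltr_nat.
- rewrite expr_div_n ler_pdivlMr ?exprn_gt0 // mulrC ler_pdivrMr //.
  by rewrite -!natrX -natrM ler_nat [leqRHS]mulnC.
apply: (only_constant_dense_few_copies_exp (i0 := 2) (i1 := 0) c_norm1) => //.
- exact: quad_coef_squares_pattern.
- by rewrite lt0r_neq0 ?quad_pattern_gt0.
Qed.

Lemma exists_expr_bracket (R : archiRealFieldType) (r x : R) (k : nat) :
  0 < r < 1 -> 0 < x < r ^+ k.+1 ->
  exists2 n, (0 < n)%N & r ^+ (n + k.+1) <= x < r ^+ (n + k).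
Proof.
move=> /andP[r_gt0 r_lt1] /andP[x_gt0 x_lt].
have small : exists n, r ^+ (n + k) <= x.
  have r_norm : `|r| < 1 by rewrite gtr0_norm.
  have [n _ /(_ n (leqnn n)) r_lt] := cvgr0_norm_lt _ (cvg_expr r_norm) _ x_gt0.
  exists n; apply: le_trans (ltW r_lt).
  rewrite ger0_norm ?exprn_ge0 ?(ltW r_gt0) //.
  by apply: ler_wiXn2l; rewrite ?leq_addr ?ltW.
have [[|[|n]] r_le n_min] := ex_minnP small.
- by move: r_le; rewrite leNgt (lt_trans x_lt) // exprSr gtr_pMr ?exprn_gt0.
- by move: r_le; rewrite leNgt x_lt.
exists n.+1 => //; rewrite addnS -addSn r_le ltNge; apply/negP => /n_min.
by rewrite ltnn.
Qed.

Lemma exprV_le_powR (R : realType) (r q x C : R) (c k n : nat) :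
  0 < r <= 1 -> 0 < q -> q^-1 <= r ^+ (k.+1 * c) -> C <= c%:R -> (0 < n)%N ->
  r ^+ (n + k) <= x <= 1 -> q ^- n <= x `^ C.
Proof.
move=> /andP[r_gt0 r_le1] q_gt0 q_le Cc n_gt0 /andP[r_le_x x_le1].
have [r_ge0 q_ge0] := (ltW r_gt0, ltW q_gt0).
have x_gt0 : 0 < x by apply: lt_le_trans r_le_x; rewrite exprn_gt0.
have x_ge0 := ltW x_gt0.
apply: (@le_trans _ _ (x ^+ c)); last first.
  by rewrite -powR_mulrn // ger_powR ?x_gt0.
apply: (@le_trans _ _ ((r ^+ (n + k)) ^+ c)); last first.
  by rewrite lerXn2r ?nnegrE ?exprn_ge0.
apply: (@le_trans _ _ ((r ^+ (k.+1 * c)) ^+ n)).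
  by rewrite -exprVn lerXn2r ?nnegrE ?invr_ge0 ?exprn_ge0.
rewrite -!exprM ler_wiXn2l // mulnAC leq_mul2r; apply/orP; right.
by rewrite mulSn leq_add2l leq_pmulr.
Qed.

Lemma exists_dense_few_quad_pattern_copies_powR (R : realType) (C : R) :
  0 < C ->
  exists (h : nat) (alpha0 : R), [/\ (0 < h)%N, 0 < alpha0 < 1 &
    forall alpha, 0 < alpha < alpha0 ->
    dense_with_few_copies (quad_pattern h) alpha (alpha `^ C)].
Proof.
move=> C_gt0; pose c := Num.bound C.
have Cc : C < c%:R by exact/archi_boundP/ltW.
have c_gt0 : (0 < c)%N by rewrite -(ltr_nat R); apply: lt_trans Cc.
have [|h [r [q [h_gt0 r_range q_gt0 q_le sparse]]]] :=
  @exists_dense_few_quad_pattern_copies R (5 * c); first by rewrite muln_gt0.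
have /andP[r_gt0 r_lt1] := r_range.
have r4_lt1 : r ^+ 4 < 1 by rewrite exprn_ilt1 // ltW.
exists h, (r ^+ 4); split=> // [|alpha alpha_range].
  by rewrite exprn_gt0.
have [n n_gt0 /andP[alpha_ge alpha_lt]] :=
  exists_expr_bracket r_range alpha_range.
apply: dense_with_few_copiesW (sparse n); first exact: ltW.
apply: exprV_le_powR q_le (ltW Cc) n_gt0 _ => //; first by rewrite r_gt0 ltW.
have /andP[_ alpha_lt_r4] := alpha_range.
by rewrite alpha_ge ltW // (lt_trans alpha_lt_r4).
Qed.

Local Open Scope classical_set_scope.

Lemma affine_copy_quad_pattern h (A : pred int) (x d : int) :
  affine_copy x d [set 0; quad_pattern h 0; quad_pattern h 1; quad_pattern h 3]
    `<=` [set y | A y] <-> copies (quad_pattern h) A d x.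
Proof.
split=> [sub|/forallP copy _ [t t_in <-]].
  apply/forallP => i; apply: sub; exists (quad_pattern h i) => //=.
  case: i => [[|[|[|[|i]]]] //= i4]; [left; left; right | left; right |
    left; left; left | right] => //.
case: t_in => [[[|]|]|] ->.
- exact: (copy 2).
- exact: (copy 0).
- exact: (copy 1).
- exact: (copy 3).
Qed.

Lemma card_fset_set_range N (P : pred int) :
  (forall x, P x -> 1 <= x <= N%:Z) ->
  finite_set [set x | P x] /\ #|` fset_set [set x | P x]| = nb_range N P.
Proof.
move=> P_range.
pose B := [fset (i : 'I_N).+1%:Z | i in [set i : 'I_N | P i.+1%:Z]%SET]%fset.
have -> : [set x | P x] = [set` B].
  apply/seteqP; split=> x /=.
    move=> Px; have /andP[x_ge1 xN] := P_range _ Px.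
    have x_lt : (`|x|.-1 < N)%N by lia.
    have xE : x = (Ordinal x_lt).+1%:Z by rewrite /=; lia.
    by rewrite xE in_imfset //= inE -xE.
  by move=> /imfsetP[i /=]; rewrite inE => + ->.
split; first exact: finite_fset.
rewrite set_fsetK card_imfset /= => [|i j [/val_inj] //].
by rewrite /nb_range cardE.
Qed.

Theorem theorem5p1 (R : realType) (C : R) (C_gt0 : 0 < C) :
  exists (alpha0 : R) (a1 a2 a3 : int),
    [/\ 0 < alpha0 < 1, 0 < a1, 0 < a2, 0 < a3 &
      forall alpha : R, 0 < alpha < alpha0 ->
      let P : set int := [set 0; a1; a2; a3] in
      \forall N \near \oo,
        exists A : set int,
          [/\ A `<=` int_range N,
              alpha * N%:R <= (#|` fset_set A|)%:R &
              forall d : int, d != 0 ->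
                card_at_most [set x : int | affine_copy x d P `<=` A]
                  (alpha `^ C * N%:R)]].
Proof.
have [h [alpha0 [h_gt0 alpha0_range sparse]]] :=
  exists_dense_few_quad_pattern_copies_powR C_gt0.
exists alpha0, (quad_pattern h 0), (quad_pattern h 1), (quad_pattern h 3).
split; rewrite ?quad_pattern_gt0 // => alpha /sparse[N0 sparseN] P.
exists N0 => // N /= /sparseN[A [A_range A_dense A_copies]].
exists [set x | A x]; split=> [x /A_range //||d d_neq0].
  by have [_ ->] := card_fset_set_range A_range.
have -> : [set x | affine_copy x d P `<=` [set y | A y]] =
    [set x | copies (quad_pattern h) A d x].
  by apply/seteqP; split=> x /affine_copy_quad_pattern.
have [|finite_copies card_copies] :=
  @card_fset_set_range N (copies (quad_pattern h) A d).
  by move=> x /forallP/(_ 2)/A_range; rewrite mulr0 addr0.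
by split=> //; rewrite card_copies A_copies.
Qed.
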